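(* Let $G=(V,E)$ be a finite directed graph with vertex weights $w:V\to\mathbb{R}^+$ such that $w(u)<w(v)$ for every $(u,v)\in E$, with edge costs $d((u,v))=w(v)-w(u)$, and let $\gamma\geq 0$ be a real threshold. Let $\leq_E$ be the reflexive and transitive closure of $E$ (a partial order on $V$, since $G$ is acyclic), used as the partial order on both factors of $V\times V$. Then the set of tight pairs of $G$ for threshold $\gamma$ coincides with $t(R_{G,\gamma})$.
   Context: A path in $G$ is a sequence $(u_1,\ldots,u_k)$, $k\geq 1$, with $(u_i,u_{i+1})\in E$; its cost is the sum of the costs of its edges (0 if $k=1$). A path $p=(u_1,\ldots,u_k)$ is tight (for $\gamma$) if its cost is $\leq\gamma$ and every path obtained by adding one new edge $(u_0,u_1)\in E$ at the start or $(u_k,u_{k+1})\in E$ at the end has cost $>\gamma$. A tight pair is a pair $(u,v)$ such that some tight path starts at $u$ and ends at $v$. $R_{G,\gamma}\subseteq V\times V$ is the set of pairs $(u,v)$ such that there is a path in $G$ from $u$ to $v$ and $w(v)-w(u)\leq\gamma$. For partially ordered sets $(A,\leq_A),(B,\leq_B)$ and $R\subseteq A\times B$, the tightening is $t(R)=\{(a,b)\in R\mid \forall a'\in A\,\forall b'\in B\,((a'\leq_A a\wedge b\leq_B b'\wedge (a',b')\in R)\Rightarrow(a'=a\wedge b'=b))\}$. *)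

(* Defs.v *)
From mathcomp Require Import all_boot all_order all_algebra.
From mathcomp Require Import boolp classical_sets reals.

Set Implicit Arguments.
Unset Strict Implicit.
Unset Printing Implicit Defensive.

Import Order.TTheory GRing.Theory Num.Theory.

Local Open Scope ring_scope.
Local Open Scope classical_set_scope.

Section Digraph.
Variables (R : realType) (V : finType) (E : rel V) (w : V -> R) (gamma : R).

Definition edge_cost (e : V * V) : R := w e.2 - w e.1.

(* The path (u_1, ..., u_k) is given by u := u_1 and p := [:: u_2; ...; u_k];
   it is a path of the graph when [path E u p], and it ends at [last u p]. *)
Definition path_cost (u : V) (p : seq V) : R :=
  \sum_(c <- pairmap (fun x y => edge_cost (x, y)) u p) c.

Definition tight_path (u : V) (p : seq V) : Prop :=
  [/\ path E u p,
      path_cost u p <= gamma,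
      forall u0 : V, E u0 u -> path_cost u0 (u :: p) > gamma
    & forall v : V, E (last u p) v -> path_cost u (rcons p v) > gamma].

Definition tight_pairs : set (V * V) :=
  [set uv | exists p : seq V, tight_path uv.1 p /\ last uv.1 p = uv.2].

Definition reach_within : set (V * V) :=
  [set uv | (exists p : seq V, path E uv.1 p /\ last uv.1 p = uv.2)
            /\ w uv.2 - w uv.1 <= gamma].

End Digraph.

(* [leA] and [leB] are meant to be partial orders; the definition itself does
   not use the order axioms. *)
Definition tightening (A B : Type) (leA : rel A) (leB : rel B)
    (S : set (A * B)) : set (A * B) :=
  [set ab | S ab /\
    forall (a' : A) (b' : B),
      leA a' ab.1 /\ leB ab.2 b' /\ S (a', b') -> a' = ab.1 /\ b' = ab.2].

(* [connect E] is the reflexive and transitive closure of [E]; strictly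
   increasing weights make it a partial order. *)
Lemma connect_partial_order (R : realType) (V : finType) (E : rel V)
    (w : V -> R) :
  (forall u v : V, E u v -> w u < w v) ->
  [/\ reflexive (connect E), antisymmetric (connect E)
    & transitive (connect E)].
Proof.
move=> Ew.
have inc u p : path E u p -> w u <= w (last u p) ?= iff (p == [::]).
  elim: p u => [|v p IHp] u /=; first by move=> _; apply/leif_refl; rewrite eqxx.
  move=> /andP[/Ew uv /IHp [vp _]]; split; first exact: le_trans (ltW uv) vp.
  by rewrite lt_eqF // (lt_le_trans uv vp).
split; [exact: connect0 | | exact: connect_trans].
move=> u v /andP[/connectP[p pp ->] /connectP[q qq qe]].
have [le1 eq1] := inc _ _ pp; have [le2 _] := inc _ _ qq.
rewrite -qe in le2.
have : w u == w (last u p) by rewrite eq_le le1 le2.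
by rewrite eq1 => /eqP ->.
Qed.

(* Main.v *)
(** Edge costs telescope, so the cost of a path depends only on its endpoints
    and can only grow when an endpoint is moved outwards along [connect E].
    Hence a pair strictly above [(u, v)] that stays within the threshold can be
    replaced by one obtained from [(u, v)] by adding a single edge at one end. *)

Require Import Defs.
From mathcomp Require Import all_boot all_order all_algebra.
From mathcomp Require Import boolp classical_sets reals.

Set Implicit Arguments.
Unset Strict Implicit.
Unset Printing Implicit Defensive.

Import Order.TTheory GRing.Theory Num.Theory.

Local Open Scope ring_scope.
Local Open Scope classical_set_scope.

Lemma connect_neq_first (V : finType) (E : rel V) (x y : V) :
  connect E x y -> x != y -> exists2 z, E x z & connect E z y.
Proof.
case/connectP=> -[|z p] /=; first by move=> _ ->; rewrite eqxx.
by case/andP=> xz zp -> _; exists z => //; apply/connectP; exists p.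
Qed.

(** Isolates the edge entering [y]: this is the edge that prolongs a tight path at its start, while
    [connect_neq_first] serves for its end. *)
Lemma connect_neq_last (V : finType) (E : rel V) (x y : V) :
  connect E x y -> x != y -> exists2 z, connect E x z & E z y.
Proof.
case/connectP=> p; case/lastP: p => [|p z]; first by move=> _ ->; rewrite eqxx.
rewrite rcons_path last_rcons => /andP[xp pz] -> _.
by exists (last x p) => //; apply/connectP; exists p.
Qed.

Lemma connect_weight_le (R : realType) (V : finType) (E : rel V) (w : V -> R) :
  (forall u v : V, E u v -> w u < w v) ->
  forall u v : V, connect E u v -> w u <= w v.
Proof.
move=> w_incr u v /connectP[p + ->].
elim: p u => [|x p IHp] u //= /andP[/w_incr ux /IHp].
exact/le_trans/ltW.
Qed.

Lemma path_costE (R : realType) (V : finType) (w : V -> R) (u : V)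
    (p : seq V) :
  path_cost w u p = w (last u p) - w u.
Proof.
elim: p u => [|x p IHp] u /=; rewrite /path_cost /= ?big_nil ?subrr //.
by rewrite big_cons -/(path_cost w x p) IHp /edge_cost /= addrC addrA subrK.
Qed.

Lemma reach_withinP (R : realType) (V : finType) (E : rel V) (w : V -> R)
    (gamma : R) (u v : V) :
  reach_within E w gamma (u, v) <-> connect E u v /\ w v - w u <= gamma.
Proof.
split=> [[[p [/= pp lp]] /= le_g] | [/connectP[p pp lp] le_g]]; split=> //=.
  by apply/connectP; exists p.
by exists p.
Qed.

(** By [path_costE] all paths from [u] to [v] cost the same, and so do their one-edge extensions to
    a given vertex; hence any path witnessing reachability is tight as soon as one is. *)
Lemma tight_pairsP (R : realType) (V : finType) (E : rel V) (w : V -> R)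
    (gamma : R) (u v : V) :
  tight_pairs E w gamma (u, v) <->
  [/\ reach_within E w gamma (u, v),
      forall u0, E u0 u -> gamma < w v - w u0
    & forall v1, E v v1 -> gamma < w v1 - w u].
Proof.
split=> [[p [[/= pp cp tl tr] /= lp]] | [[[p [/= pp lp]] le_g] tl tr]].
  rewrite lp in tr; rewrite path_costE lp in cp.
  split=> [|u0 /tl|v1 /tr]; rewrite ?path_costE ?last_rcons /= ?lp //.
  by split=> //; exists p.
exists p; split=> //; split=> //=; first by rewrite path_costE lp.
  by move=> u0 /tl; rewrite path_costE /= lp.
by move=> v1; rewrite lp path_costE last_rcons => /tr.
Qed.

Theorem theorem1 (R : realType) (V : finType) (E : rel V) (w : V -> R)
    (w_gt0 : forall v : V, 0 < w v)
    (w_incr : forall u v : V, E u v -> w u < w v)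
    (gamma : R) (gamma_ge0 : 0 <= gamma) :
  tight_pairs E w gamma
  = tightening (connect E) (connect E) (reach_within E w gamma).
Proof.
apply/seteqP; split=> -[u v].
  case/tight_pairsP=> uv tl tr; split=> //= a b [au [vb /reach_withinP[_ abg]]].
  have wau := connect_weight_le w_incr au.
  have wvb := connect_weight_le w_incr vb.
  split; apply/eqP; apply/negPn/negP.
    (* If [a != u], some edge [z -> u] has [w a <= w z], so [w v - w z <= w b - w a <= gamma],
       against tightness at the start. *)
    case/(connect_neq_last au)=> z /(connect_weight_le w_incr) waz /tl.
    by rewrite ltNge (le_trans _ abg) // lerB.
  rewrite eq_sym => /(connect_neq_first vb)[z /tr + /(connect_weight_le w_incr)].
  by move=> + wzb; rewrite ltNge (le_trans _ abg) // lerB.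
(* Conversely, a one-edge extension of cost at most [gamma] yields a pair of [reach_within] above
   [(u, v)]. Maximality then identifies the two ends of the new edge, which contradicts the strict
   increase of [w]. *)
case=> uv maxuv; apply/tight_pairsP; split=> // [u0 u0u | v1 vv1];
  rewrite ltNge; apply/negP => le_g; have /reach_withinP[cuv _] := uv.
  have [] := maxuv u0 v.
    split; [exact: connect1 | split; first exact: connect0].
    by apply/reach_withinP; split=> //; apply: connect_trans (connect1 u0u) cuv.
  by move=> /= eq_u _; have := w_incr _ _ u0u; rewrite eq_u ltxx.
have [] := maxuv u v1.
  split; [exact: connect0 | split; first exact: connect1].
  by apply/reach_withinP; split=> //; apply: connect_trans cuv (connect1 vv1).
by move=> _ /= eq_v; have := w_incr _ _ vv1; rewrite eq_v ltxx.
Qed.
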